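(* Let $N\ge2$ be an integer. If $(\alpha_1,\dots,\alpha_N)\in DC_N(C,\tau)$ for some $C,\tau>0$, then $\mathcal{B}(\alpha_1,\dots,\alpha_N)<+\infty$.
   Context: Irrationals $\alpha_1,\dots,\alpha_N\in(0,1)$ are called rationally independent if $\alpha_1,\dots,\alpha_N$ are linearly independent over $\mathbb{Q}$. For $C,\tau>0$, $DC_N(C,\tau)$ is the set of $N$-tuples $(\alpha_1,\dots,\alpha_N)$ of rationally independent irrationals in $(0,1)$ such that $$\max_{1\le j\le N}|q\alpha_j-p_j|\ge \frac{C}{|q|^\tau}$$ for all integers $p_1,\dots,p_N,q$ with $q\ne0$. Gauss maps. For rationally independent irrationals $\alpha_1,\dots,\alpha_N\in(0,1)$ and $w\in\{1,\dots,N\}$, put $\hat\alpha_i=\alpha_i$ for $i\ne w$ and $\hat\alpha_w=1$. Let $a_i$ be the integer with $|a_i\alpha_w-\hat\alpha_i|=\min_{k\in\mathbb{Z}}|k\alpha_w-\hat\alpha_i|<\tfrac12\alpha_w$, and let $\tilde\alpha_i=|a_i\alpha_w-\hat\alpha_i|/\alpha_w\in(0,1/2)$. Define $G(\alpha_1,\dots,\alpha_N,w)=(\tilde\alpha_1,\dots,\tilde\alpha_N)$. Brjuno-type function. For an infinite word $\overline w=(w(n))_{n\ge0}\in\{1,\dots,N\}^{\mathbb{N}}$ let $\alpha_i^{(0)}=\alpha_i$ and $(\alpha_1^{(n+1)},\dots,\alpha_N^{(n+1)})=G(\alpha_1^{(n)},\dots,\alpha_N^{(n)},w(n))$ for $n\ge0$.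 Define $$\mathcal{B}(\alpha_1,\dots,\alpha_N,\overline w)=\sum_{n=0}^\infty \alpha^{(0)}_{w(0)}\cdots\alpha^{(n-1)}_{w(n-1)}\log\frac{1}{\alpha^{(n)}_{w(n)}},$$ where the empty product (for $n=0$) equals $1$, and $$\mathcal{B}(\alpha_1,\dots,\alpha_N)=\inf_{\overline w\in\{1,\dots,N\}^{\mathbb{N}}}\mathcal{B}(\alpha_1,\dots,\alpha_N,\overline w).$$ *)

(* Defs.v *)
From HB Require Import structures.
From mathcomp Require Import all_boot all_order all_algebra.
From mathcomp Require Import all_classical all_reals all_analysis.
From mathcomp Require Import lra.

Set Implicit Arguments.
Unset Strict Implicit.
Unset Printing Implicit Defensive.

Import Order.TTheory GRing.Theory Num.Theory.

Local Open Scope classical_set_scope.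
Local Open Scope ring_scope.

(* Tuples (alpha_1, ..., alpha_N) are functions on 'I_N, i.e. indexed from 0. *)

(* Linear independence over Q of alpha_1, ..., alpha_N alone: the number 1 is
   not adjoined to the family. *)
Definition Q_lin_indep (R : realType) (N : nat) (alpha : 'I_N -> R) : Prop :=
  forall c : 'I_N -> rat,
    \sum_(i < N) ratr (c i) * alpha i = 0 -> forall i, c i = 0.

Definition rationally_independent (R : realType) (N : nat)
    (alpha : 'I_N -> R) : Prop :=
  [/\ forall i, irrational (alpha i),
      forall i, 0 < alpha i < 1
    & Q_lin_indep alpha].

(* The default value 0 of the iterated maximum is harmless for N > 0, the
   terms being nonnegative. *)
Definition DC (R : realType) (N : nat) (C tau : R) : set ('I_N -> R) :=
  [set alpha | rationally_independent alpha /\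
    forall (p : 'I_N -> int) (q : int), q != 0 ->
      C / `|q%:~R| `^ tau
        <= \big[Num.max/0]_(j < N) `|q%:~R * alpha j - (p j)%:~R| ].

(* An integer a minimizing |a x - y|; for 0 < x it exists (nearest_multP), and
   the minimum does not depend on the choice of a in case of a tie. *)
Definition nearest_mult (R : realType) (x y : R) : int :=
  @xget int 0 [set a : int | forall k : int,
                          `|a%:~R * x - y| <= `|k%:~R * x - y|].

Lemma nearest_multP (R : realType) (x y : R) (k : int) : 0 < x ->
  `|(nearest_mult x y)%:~R * x - y| <= `|k%:~R * x - y|.
Proof.
move=> x0; rewrite /nearest_mult; case: xgetP => [a _ //|none].
have scale (m : int) : `|m%:~R * x - y| = `|m%:~R - y / x| * x.
  by rewrite -{3}(gtr0_norm x0) -normrM mulrBl divfK ?gt_eqF.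
pose f := Num.floor (y / x); pose r := y / x - f%:~R.
have r0 : 0 <= r by rewrite subr_ge0 floor_le.
have r1 : r <= 1 by rewrite lerBlDl -intrD1 ltW // floorD1_gt.
have below (m : int) : m <= f -> r <= `|m%:~R - y / x|.
  move=> mf; rewrite distrC; apply: le_trans (ler_norm _).
  by rewrite lerD2l lerN2 ler_int.
have above (m : int) : f < m -> 1 - r <= `|m%:~R - y / x|.
  rewrite -lezD1 -(ler_int R) intrD => fm; apply: le_trans (ler_norm _).
  by rewrite /r; lra.
have fE : `|f%:~R - y / x| = r by rewrite distrC ger0_norm.
have f1E : `|(f + 1)%:~R - y / x| = 1 - r.
  by rewrite intrD -(ger0_norm (_ : 0 <= 1 - r)) ?subr_ge0 //; congr `|_|; rewrite /r; lra.
case: (leP r (1 - r)) => rh; [case: (none f)|case: (none (f + 1))] => m;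
  rewrite !scale ler_pM2r // ?fE ?f1E.
  by case: (leP m f) => [/below//|/above]; apply: le_trans.
by case: (leP m f) => [/below|/above//]; apply: le_trans; exact: ltW.
Qed.

Definition gauss (R : realType) (N : nat) (alpha : 'I_N -> R) (w : 'I_N) :
    'I_N -> R :=
  fun i => let hat := if i == w then 1 else alpha i in
           `|(nearest_mult (alpha w) hat)%:~R * alpha w - hat| / alpha w.

Fixpoint gauss_iter (R : realType) (N : nat) (alpha : 'I_N -> R)
    (w : nat -> 'I_N) (n : nat) : 'I_N -> R :=
  if n is m.+1 then gauss (gauss_iter alpha w m) (w m) else alpha.

(* In \bar R the inverse of 0 is +oo, and so is its logarithm: a word along
   which some selected alpha_{w(n)}^{(n)} vanishes (possible when 1 is in the
   Q-span of the alpha_i) has value +oo, not the junk value of ln (0^-1). *)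
Definition brjuno_word (R : realType) (N : nat) (alpha : 'I_N -> R)
    (w : nat -> 'I_N) : \bar R :=
  (\sum_(0 <= n <oo)
     ((\prod_(m < n) gauss_iter alpha w m (w m))%R%:E
        * lne ((gauss_iter alpha w n (w n))%:E)^-1))%E.

Definition brjuno (R : realType) (N : nat) (alpha : 'I_N -> R) : \bar R :=
  ereal_inf [set brjuno_word alpha w | w in [set: nat -> 'I_N]].

(* Main.v *)
(* Take the greedy word: at each step select the largest entry m_n of
   alpha^(n), and let b_n = m_0 ... m_(n-1), so that b_n <= 2 * 2^-n. Inverting
   the Gauss steps writes 1 and each alpha_j as b_n times an integer affine form
   in alpha^(n) whose coefficients have total size at most 3^n / b_n. By
   greediness these forms are within 3^n m_n of b_n q and b_n p_j, for integers
   q, p_j (the constant terms). Unless m_n >= 3^-n / 2, this makes q nonzero and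
   comparable to 1 / b_n, and max_j |q alpha_j - p_j| = O(9^n m_n / b_n); the
   Diophantine condition then bounds m_n from below by a constant times
   b_n^(5 + tau), as 9^n = O(b_n^-4). Hence the n-th term b_n log (1 / m_n) of
   the series is O(sqrt b_n), which decays geometrically. *)
Require Import Defs.
From HB Require Import structures.
From mathcomp Require Import all_boot all_order all_algebra.
From mathcomp Require Import all_classical all_reals all_analysis.
From mathcomp Require Import ring lra.

Set Implicit Arguments.
Unset Strict Implicit.
Unset Printing Implicit Defensive.

Import Order.TTheory GRing.Theory Num.Theory.

Local Open Scope classical_set_scope.
Local Open Scope ring_scope.

(** * One Gauss step acting on integer affine forms *)

Lemma nearest_mult_le_half (R : realType) (x y : R) : 0 < x ->
  `|(nearest_mult x y)%:~R * x - y| <= x / 2.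
Proof.
move=> x0; set k := Num.floor (y / x + 2^-1).
apply: le_trans (nearest_multP y k x0) _.
have -> : k%:~R * x - y = (k%:~R - y / x) * x by rewrite mulrBl divfK ?gt_eqF.
rewrite normrM (gtr0_norm x0) mulrC ler_pM2l // ler_norml.
have := floor_le (y / x + 2^-1); have := floorD1_gt (y / x + 2^-1).
by rewrite intrD -/k => *; apply/andP; split; lra.
Qed.

Section GaussStep.
Variables (R : realType) (N : nat).
Implicit Types (alpha : 'I_N -> R) (e : 'I_N -> int) (w : nat -> 'I_N).

Definition int_form alpha (c : int) e : R :=
  c%:~R + \sum_i (e i)%:~R * alpha i.

(** The constant term counts too, since a Gauss step exchanges it with the selected coefficient. *)
Definition int_height (c : int) e : R :=
  `|c%:~R| + \sum_i `|(e i)%:~R|.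

Lemma gauss_ge0 alpha j i : 0 < alpha j -> 0 <= gauss alpha j i.
Proof. by move=> j0; rewrite divr_ge0 ?normr_ge0 ?ltW. Qed.

Lemma gauss_le_half alpha j i : 0 < alpha j -> gauss alpha j i <= 2^-1.
Proof. by move=> j0; rewrite ler_pdivrMr // [leRHS]mulrC nearest_mult_le_half. Qed.

(** [s i] is the sign of the rounding error. Since [|a i| * alpha j] exceeds its target, which is at
    most 1, by at most [alpha j / 2], the product of [1 + |a i|] and [alpha j] is at most 5/2,
    rounded up to 3. *)
Lemma gauss_decomp alpha j : 0 < alpha j -> (forall i, 0 <= alpha i <= 1) ->
  exists a s : 'I_N -> int, forall i,
    [/\ (if i == j then 1 else alpha i)
          = alpha j * ((a i)%:~R + (s i)%:~R * gauss alpha j i),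
        `|(s i)%:~R : R| = 1 & 1 + `|(a i)%:~R| <= 3 / alpha j].
Proof.
move=> j0 a01; pose hat i := if i == j then 1 else alpha i.
have hat01 i : 0 <= hat i <= 1 by rewrite /hat; case: ifP; rewrite ?ler01 ?lexx.
pose a i := nearest_mult (alpha j) (hat i).
pose s i : int := if 0 <= hat i - (a i)%:~R * alpha j then 1 else -1.
exists a, s => i; split.
- rewrite -/(hat i) /gauss -/(hat i) -/(a i) mulrDr.
  rewrite (mulrCA _ (s i)%:~R) [alpha j * (_ / _)]mulrC divfK ?gt_eqF //.
  rewrite distrC /s; case: ifPn => [h|]; first by rewrite ger0_norm //; ring.
  by rewrite -ltNge => h; rewrite ltr0_norm //; ring.
- by rewrite /s; case: ifP => _; rewrite ?normrN normr1.
- rewrite ler_pdivlMr // mulrDl mul1r -{2}(gtr0_norm j0) -normrM.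
  have /andP[h0 h1] := hat01 i; have /andP[_ j1] := a01 j.
  have := nearest_mult_le_half (hat i) j0; rewrite -/(a i).
  have := ler_normD ((a i)%:~R * alpha j - hat i) (hat i).
  by rewrite subrK (ger0_norm h0); lra.
Qed.

Lemma int_form_gauss alpha j c e :
  0 < alpha j -> (forall i, 0 <= alpha i <= 1) ->
  exists c' e', int_form alpha c e = alpha j * int_form (gauss alpha j) c' e' /\
    int_height c' e' <= 3 / alpha j * int_height c e.
Proof.
move=> j0 a01; have [a [s H]] := gauss_decomp j0 a01.
(* The selected coordinate and the constant term trade places. *)
pose d i := if i == j then c else e i.
exists (e j + \sum_i d i * a i), (fun i => d i * s i); split.
  transitivity (alpha j * (e j)%:~R
      + \sum_i (d i)%:~R * (if i == j then 1 else alpha i)).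
    rewrite /int_form (bigD1 j) //= [in RHS](bigD1 j) //= /d eqxx.
    under [in RHS]eq_bigr => i /negbTE -> do [].
    by ring.
  rewrite /int_form intrD rmorph_sum /= -addrA -big_split /= mulrDr mulr_sumr.
  congr (_ + _); apply: eq_bigr => i _; have [-> _ _] := H i.
  by rewrite !intrM; ring.
have B1 : 1 <= 3 / alpha j.
  by have [_ _] := H j; apply: le_trans; rewrite lerDl.
have hE : int_height c e = `|(e j)%:~R| + \sum_i `|(d i)%:~R|.
  rewrite /int_height (bigD1 j) //= [in RHS](bigD1 j) //= /d eqxx.
  under [in RHS]eq_bigr => i /negbTE -> do [].
  by ring.
rewrite hE /int_height mulrDr mulr_sumr intrD rmorph_sum /=.
have le1 : `|(e j)%:~R : R| <= 3 / alpha j * `|(e j)%:~R|.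
  by rewrite ler_peMl.
have := ler_normD ((e j)%:~R : R) (\sum_i (d i * a i)%:~R).
have := ler_norm_sum (index_enum 'I_N) (fun i => (d i * a i)%:~R : R) xpredT.
(* Substitution turns each [d i] into [d i * a i] in the constant term and [d i * s i] as a
   coefficient, so it costs a factor [1 + |a i|]. *)
suff : \sum_i `|(d i * a i)%:~R : R| + \sum_i `|(d i * s i)%:~R|
    <= \sum_i 3 / alpha j * `|(d i)%:~R : R| by lra.
rewrite -big_split /=; apply: ler_sum => i _; have [_ s1 aB] := H i.
by rewrite !intrM !normrM s1 -mulrDr mulrC ler_wpM2r // addrC.
Qed.

(** * Iterated Gauss steps along a word *)

Definition gauss_prod alpha w n : R := \prod_(m < n) gauss_iter alpha w m (w m).

Lemma gauss_prodS alpha w n :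
  gauss_prod alpha w n.+1 = gauss_prod alpha w n * gauss_iter alpha w n (w n).
Proof. exact: big_ord_recr. Qed.

Lemma gauss_prod_gt0 alpha w n :
  (forall m, (m < n)%N -> 0 < gauss_iter alpha w m (w m)) ->
  0 < gauss_prod alpha w n.
Proof. by move=> pos; apply: prodr_gt0 => m _; exact: pos. Qed.

Lemma gauss_iter01 alpha w n :
  (forall m, (m < n)%N -> 0 < gauss_iter alpha w m (w m)) ->
  (forall i, 0 <= alpha i <= 1) -> forall i, 0 <= gauss_iter alpha w n i <= 1.
Proof.
case: n => [//|n] pos _ i /=; rewrite gauss_ge0 ?pos //=.
by apply: le_trans (gauss_le_half _ (pos _ (ltnSn n))) _; lra.
Qed.

Lemma gauss_prod_le1 alpha w n :
  (forall m, (m < n)%N -> 0 < gauss_iter alpha w m (w m)) ->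
  (forall i, 0 <= alpha i <= 1) -> gauss_prod alpha w n <= 1.
Proof.
move=> pos a01; apply: prodr_ile1 => m _; apply: gauss_iter01 => // k km.
exact/pos/(ltn_trans km).
Qed.

(** From the second on, each factor is an output of [gauss], hence at most 1/2; the first is only
    known to be at most 1, which costs the extra 2. *)
Lemma gauss_prod_le alpha w n :
  (forall m, (m < n)%N -> 0 < gauss_iter alpha w m (w m)) ->
  (forall i, 0 <= alpha i <= 1) -> gauss_prod alpha w n <= 2 / 2 ^+ n.
Proof.
move=> + a01; elim: n => [|n IH] pos.
  by rewrite /gauss_prod big_ord0 expr0; lra.
have posn m : (m < n)%N -> 0 < gauss_iter alpha w m (w m).
  by move=> mn; exact/pos/ltnW.
rewrite gauss_prodS; case: n IH pos posn => [|n] IH pos posn.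
  rewrite /gauss_prod big_ord0 mul1r expr1 divff //.
  by have /andP[] := a01 (w 0).
rewrite [2 ^+ n.+2]exprSr invfM [leRHS]mulrA; apply: ler_pM; rewrite ?IH //.
- by rewrite ltW // gauss_prod_gt0.
- by rewrite ltW // pos.
- by rewrite /= gauss_le_half ?posn.
Qed.

Lemma int_form_gauss_iter alpha w n c e :
  (forall m, (m < n)%N -> 0 < gauss_iter alpha w m (w m)) ->
  (forall i, 0 <= alpha i <= 1) ->
  exists c' e', int_form alpha c e
      = gauss_prod alpha w n * int_form (gauss_iter alpha w n) c' e' /\
    int_height c' e' <= 3 ^+ n / gauss_prod alpha w n * int_height c e.
Proof.
move=> + a01; elim: n => [|n IH] pos.
  exists c, e; rewrite /gauss_prod big_ord0 expr0.
  by rewrite divr1 !mul1r.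
have posn m : (m < n)%N -> 0 < gauss_iter alpha w m (w m).
  by move=> mn; exact/pos/ltnW.
have [c1 [e1 [-> h1]]] := IH posn.
have [c2 [e2 [-> h2]]] :=
  int_form_gauss c1 e1 (pos _ (ltnSn n)) (gauss_iter01 posn a01).
exists c2, e2; split; first by rewrite gauss_prodS mulrA.
apply: le_trans h2 _; rewrite gauss_prodS exprS invfM.
have B0 : 0 <= 3 / gauss_iter alpha w n (w n) by rewrite divr_ge0 // ltW // pos.
apply: le_trans (ler_wpM2l B0 h1) _.
by rewrite le_eqVlt; apply/orP; left; apply/eqP; ring.
Qed.

Lemma int_form_near alpha M c e : 0 <= M -> (forall i, 0 <= alpha i <= M) ->
  `|int_form alpha c e - c%:~R| <= int_height c e * M.
Proof.
move=> M0 aM; rewrite /int_form addrC addKr.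
apply: le_trans (ler_norm_sum _ _ _) _.
apply: (@le_trans _ _ ((\sum_i `|(e i)%:~R|) * M)); last first.
  by rewrite ler_wpM2r ?lerDr.
rewrite mulr_suml; apply: ler_sum => i _.
have /andP[a0 aM'] := aM i.
by rewrite normrM (ger0_norm a0) ler_wpM2l.
Qed.

(** [p] is the constant term after [n] Gauss steps. The factor [gauss_prod] in front of the form
    cancels the denominator of the height bound, so the error is free of it. *)
Lemma int_form_approx alpha w n M c e :
  (forall m, (m < n)%N -> 0 < gauss_iter alpha w m (w m)) ->
  (forall i, 0 <= alpha i <= 1) ->
  0 <= M -> (forall i, gauss_iter alpha w n i <= M) ->
  int_height c e = 1 ->
  exists p : int,
    `|int_form alpha c e - gauss_prod alpha w n * p%:~R| <= 3 ^+ n * M /\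
    `|p%:~R| <= 3 ^+ n / gauss_prod alpha w n.
Proof.
move=> pos a01 M0 aM h1; have b0 := gauss_prod_gt0 pos.
have [p [e' [-> +]]] := int_form_gauss_iter c e pos a01.
rewrite h1 mulr1 => h; exists p; split; last first.
  by apply: le_trans h; rewrite lerDl sumr_ge0.
have aM' i : 0 <= gauss_iter alpha w n i <= M.
  by rewrite aM; have /andP[-> _] := gauss_iter01 pos a01 i.
rewrite -mulrBr normrM (gtr0_norm b0).
have := le_trans (int_form_near p e' M0 aM') (ler_wpM2r M0 h).
by rewrite mulrAC ler_pdivlMr // mulrC.
Qed.

End GaussStep.

(** * Lower bound for the largest entry from the Diophantine condition *)

Lemma simultaneous_error_le (R : realFieldType) (T b m x p q : R) :
  1 <= T -> 0 < b -> 0 <= m -> T * m <= 2^-1 ->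
  `|1 - b * q| <= T * m -> `|x - b * p| <= T * m -> `|p| <= T / b ->
  `|q * x - p| <= 3 * T ^+ 2 * m / b.
Proof.
move=> T1 b0 m0 Tm hq hx hp.
(* The products [p * q * b] cancel, leaving the two approximation errors weighted by [q] and [p]. *)
have -> : q * x - p = q * (x - b * p) - p * (1 - b * q) by ring.
have qb : `|q| <= 2 / b.
  rewrite ler_pdivlMr // -{1}(gtr0_norm b0) -normrM mulrC.
  move: hq Tm; rewrite !ler_norml => /andP[? ?] ?; apply/andP; split; lra.
have Tm0 : 0 <= T * m by rewrite mulr_ge0 //; lra.
apply: le_trans (ler_normB _ _) _; rewrite !normrM.
have := ler_pM (normr_ge0 _) (normr_ge0 _) qb hx.
have := ler_pM (normr_ge0 _) (normr_ge0 _) hp hq.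
have -> : T / b * (T * m) = T ^+ 2 * m / b by ring.
have : 2 / b * (T * m) <= 2 * (T ^+ 2 * m / b).
  rewrite -subr_ge0.
  have -> : 2 * (T ^+ 2 * m / b) - 2 / b * (T * m)
    = 2 * (T - 1) * (T * m) / b by ring.
  by rewrite divr_ge0 ?(ltW b0) // mulr_ge0 // mulr_ge0 // subr_ge0.
by lra.
Qed.

(** In the exponent, the square of [3 ^+ n] costs four powers of [1 / b], the division by [b] a
    fifth, and the power of [|q|] the remaining [tau]; 48 is [3 * 2 ^+ 4]. Positivity is assumed
    only before step [n], so that it can be propagated by induction. *)
Lemma DC_gauss_lower_bound (R : realType) (N : nat) (alpha : 'I_N -> R)
    (C tau : R) (w : nat -> 'I_N) (n : nat) :
  0 < C -> 0 < tau -> DC C tau alpha ->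
  (forall m, (m < n)%N -> 0 < gauss_iter alpha w m (w m)) ->
  (forall i, gauss_iter alpha w n i <= gauss_iter alpha w n (w n)) ->
  Num.min (8^-1) (C / (48 * 2 `^ tau)) * gauss_prod alpha w n `^ (5 + tau)
    <= gauss_iter alpha w n (w n).
Proof.
move=> C0 tau0 [[_ a01' _] dc] pos wmax.
have a01 i : 0 <= alpha i <= 1 by have /andP[? ?] := a01' i; rewrite !ltW.
have b0 := gauss_prod_gt0 pos; have b2 := gauss_prod_le pos a01.
have m0 : 0 <= gauss_iter alpha w n (w n).
  by have /andP[] := gauss_iter01 pos a01 (w n).
set b := gauss_prod alpha w n in b0 b2 *.
set m := gauss_iter alpha w n (w n) in wmax m0 *.
have b1 : b <= 1 := gauss_prod_le1 pos a01.
(* Bound 3 by 4, the square of 2, and use that [2 ^+ n] is at most [2 / b]. *)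
have T4 : 3 ^+ n <= (2 / b) ^+ 2.
  apply: (@le_trans _ _ ((2 ^+ n) ^+ 2)).
    by rewrite -exprM mulnC exprM lerXn2r ?nnegrE // -natrX ler_nat.
  apply: lerXn2r; rewrite ?nnegrE ?divr_ge0 ?exprn_ge0 ?(ltW b0) //.
  by move: b2; rewrite !ler_pdivlMr ?exprn_gt0 // mulrC.
have T1 : 1 <= 3 ^+ n :> R by rewrite exprn_ege1 // ler1n.
(* If [3 ^+ n * m] is at least 1/2, then [m] is at least [b ^+ 2 / 8] without Diophantine input;
   this accounts for [8^-1]. *)
have [Tm|/ltW Tm] := leP (2^-1) (3 ^+ n * m).
  apply: (@le_trans _ _ (8^-1 * b ^+ 2)).
    rewrite ler_pM ?powR_ge0 ?le_min ?ge_min ?lexx //.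
      by rewrite invr_ge0 ler0n /= ltW // divr_gt0 // mulr_gt0 // powR_gt0 //.
    by rewrite -(powR_mulrn 2 (ltW b0)) // ger_powR ?b0 //; lra.
  have := le_trans Tm (ler_wpM2r m0 T4).
  rewrite expr_div_n mulrAC ler_pdivlMr ?exprn_gt0 //; lra.
(* The forms [alpha j] and 1 both have height 1; their constant terms after [n] steps supply [p j]
   and [q]. *)
have deltaE j : int_form alpha 0 (fun i => (i == j)%:R) = alpha j.
  rewrite /int_form mulr0z add0r (bigD1 j) //= eqxx mul1r big1 ?addr0 // => i.
  by move/negbTE->; rewrite mul0r.
have delta_height (j : 'I_N) : int_height R 0 (fun i => (i == j)%:R) = 1.
  rewrite /int_height mulr0z normr0 add0r (bigD1 j) //= eqxx normr1.
  rewrite big1 ?addr0 // => i.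
  by move/negbTE->; rewrite normr0.
have oneE : int_form alpha 1 (fun=> 0) = 1.
  by rewrite /int_form big1 ?addr0 // => i _; rewrite mul0r.
have one_height : @int_height R N 1 (fun=> 0) = 1.
  by rewrite /int_height normr1 big1 ?addr0 // => i _; rewrite normr0.
have [q [+ _]] := int_form_approx pos a01 m0 wmax one_height.
rewrite oneE -/b => hq.
have /fin_all_exists[p hp] j := int_form_approx pos a01 m0 wmax (delta_height j).
(* As [3 ^+ n * m] is at most 1/2, [b * q] stays within 1/2 of 1, so [q] is nonzero and the
   Diophantine condition applies. *)
have qb : 2^-1 <= b * q%:~R <= 3 / 2.
  by move: hq; rewrite ler_norml => /andP[? ?]; apply/andP; split; lra.
have q0 : 0 < q%:~R :> R.
  by rewrite -(pmulr_rgt0 _ b0); have /andP[? _] := qb; lra.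
have qn0 : q != 0 by rewrite -(intr_eq0 R) gt_eqF.
have : C / `|q%:~R| `^ tau <= 3 * (3 ^+ n) ^+ 2 * m / b.
  apply: le_trans (dc p q qn0) _.
  (* The iterated maximum starts from 0, so the bound itself must be nonnegative. *)
  have B0 : 0 <= 3 * (3 ^+ n) ^+ 2 * m / b.
    by rewrite divr_ge0 ?mulr_ge0 ?sqr_ge0 ?(ltW b0).
  apply: (big_ind (fun x => x <= 3 * (3 ^+ n) ^+ 2 * m / b)) => //.
    by move=> x y xB yB; rewrite ge_max xB.
  move=> j _; have [hx hpj] := hp j; rewrite deltaE in hx.
  exact: simultaneous_error_le.
have qle : `|q%:~R| `^ tau <= (2 / b) `^ tau.
  apply: ge0_ler_powR; rewrite ?nnegrE ?divr_ge0 ?(ltW b0) ?(ltW tau0) //.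
  by rewrite gtr0_norm // ler_pdivlMr // mulrC; have /andP[_ ?] := qb; lra.
have Q0 : 0 < `|q%:~R| `^ tau :> R by rewrite powR_gt0 // normr_gt0 gt_eqF.
rewrite ler_pdivrMr // => hC.
have hC1 : C <= 3 * (2 / b) ^+ 4 * m / b * (2 / b) `^ tau.
  apply: (le_trans hC); rewrite ler_pM ?powR_ge0 //.
    by rewrite divr_ge0 ?mulr_ge0 ?sqr_ge0 ?(ltW b0).
  rewrite ler_wpM2r ?invr_ge0 ?(ltW b0) // ler_wpM2r // ler_wpM2l //.
  rewrite (exprM _ 2 2) lerXn2r ?nnegrE ?sqr_ge0 //; lra.
apply: (@le_trans _ _ (C / (48 * 2 `^ tau) * b `^ (5 + tau))).
  by rewrite ler_wpM2r ?powR_ge0 // ge_min lexx orbT.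
rewrite mulrAC ler_pdivrMr ?mulr_gt0 ?powR_gt0 //.
rewrite powRD ?(gt_eqF b0) ?implybT // powR_mulrn ?(ltW b0) //.
have bt0 : 0 < b `^ tau by rewrite powR_gt0.
have powE : (2 / b) `^ tau = 2 `^ tau / b `^ tau.
  apply: (canRL (mulfK _)); first by rewrite gt_eqF.
  by rewrite -powRM ?divr_ge0 ?(ltW b0) // divfK // gt_eqF.
move: hC1; rewrite powE.
have -> : 3 * (2 / b) ^+ 4 * m / b * (2 `^ tau / b `^ tau)
  = m * (48 * 2 `^ tau) / (b ^+ 5 * b `^ tau) by field; rewrite !gt_eqF.
by rewrite ler_pdivlMr // mulr_gt0 ?exprn_gt0.
Qed.

(** * Logarithms against square roots, and comparison with a geometric series *)

Lemma neg_ln_le_sqrt (R : realType) (x : R) : 0 < x ->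
  - ln x <= 2 / Num.sqrt x.
Proof.
move=> x0; have r0 : 0 < Num.sqrt x by rewrite sqrtr_gt0.
(* The inequality [ln y < y] at the inverse square root of [x], to be doubled. *)
have := ln_sublinear (_ : 0 < (Num.sqrt x)^-1); rewrite invr_gt0 => /(_ r0).
have -> : ln x = ln (Num.sqrt x) *+ 2 by rewrite -lnXn // sqr_sqrtr // ltW.
by rewrite lnV ?posrE // mulr2n; lra.
Qed.

(** Giving up a square root of [b] absorbs [ln b]; the contribution of [c] uses that [b] is at most
    its square root and that [ln c <= 0]. *)
Lemma mul_ln_inv_le_sqrt (R : realType) (c k b m : R) :
  0 < c <= 1 -> 0 <= k -> 0 < b <= 1 -> c * b `^ k <= m ->
  b * ln m^-1 <= (2 * k - ln c) * Num.sqrt b.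
Proof.
move=> /andP[c0 c1] k0 /andP[b0 b1] cbm.
have r0 : 0 < Num.sqrt b by rewrite sqrtr_gt0.
have cb0 : 0 < c * b `^ k by rewrite mulr_gt0 // powR_gt0.
have m0 : 0 < m by apply: lt_le_trans cbm.
have lnm : ln m^-1 <= - ln c + k * (2 / Num.sqrt b).
  have : ln (c * b `^ k) <= ln m by rewrite ler_ln ?posrE.
  rewrite lnV ?posrE // lnM ?posrE ?powR_gt0 // ln_powR.
  by have := ler_wpM2l k0 (neg_ln_le_sqrt b0); lra.
have bsqrt : b <= Num.sqrt b.
  rewrite -{1}(sqr_sqrtr (ltW b0)) expr2 ler_piMl ?(ltW r0) //.
  by rewrite -[leRHS]sqrtr1 ler_wsqrtr.
apply: le_trans (ler_wpM2l (ltW b0) lnm) _.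
have -> : b * (- ln c + k * (2 / Num.sqrt b))
    = - ln c * b + 2 * k * Num.sqrt b.
  by rewrite -{1 3}(sqr_sqrtr (ltW b0)); field; rewrite gt_eqF.
rewrite mulrBl -mulNr addrC lerD2l ler_wpM2l // oppr_ge0.
exact: ln_le0.
Qed.

Lemma nneseries_geometric_lty (R : realType) (u : (\bar R)^nat) (a z : R) :
  0 <= z < 1 -> (forall n, 0 <= u n <= (a * z ^+ n)%:E)%E ->
  (\sum_(0 <= n <oo) u n < +oo)%E.
Proof.
move=> /andP[z0 z1] ub.
have a0 : 0 <= a.
  have /andP[] := ub 0; rewrite expr0 mulr1 -lee_fin; exact: le_trans.
apply: (@le_lt_trans _ _ (a / (1 - z))%:E); last exact: ltry.
apply: lime_le; first by apply: is_cvg_nneseries => n _ _; have /andP[] := ub n.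
apply: nearW => n.
apply: (@le_trans _ _ (\sum_(0 <= i < n) (a * z ^+ i)%:E)%E).
  by apply: lee_sum => i _; have /andP[] := ub i.
rewrite sumEFin lee_fin.
have := @geometric_seriesE R a z.
rewrite lt_eqF // => /(_ isT) /(congr1 (@^~ n)).
rewrite /series /= => ->; rewrite ler_pM2r ?invr_gt0 ?subr_gt0 //.
by rewrite ler_piMr // lerBlDr lerDl exprn_ge0.
Qed.

(** * The greedy word and the convergence of its series *)

Lemma greedy_word (R : realType) (N : nat) (alpha : 'I_N -> R) : (0 < N)%N ->
  exists w : nat -> 'I_N, forall n i,
    gauss_iter alpha w n i <= gauss_iter alpha w n (w n).
Proof.
move=> N0; pose amax (f : 'I_N -> R) := [arg max_(i > Ordinal N0) f i]%O.
(* Each letter depends on the tuple reached by the earlier letters, so the orbit [st] is built first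
   and the word read off from it. *)
pose st := fix st n := if n is m.+1 then gauss (st m) (amax (st m)) else alpha.
exists (amax \o st) => n i.
have -> : gauss_iter alpha (amax \o st) n = st n.
  by elim: n => //= n ->.
by rewrite /= /amax; case: arg_maxP => // j _; exact.
Qed.

Theorem proposition5p3 (R : realType) (N : nat) (hN : (2 <= N)%N)
    (alpha : 'I_N -> R)
    (hDC : exists C tau : R, [/\ 0 < C, 0 < tau & DC C tau alpha]) :
  (brjuno alpha < +oo)%E.
Proof.
have [C [tau [C0 tau0 dc]]] := hDC.
have [[_ a01' _] _] := dc.
have a01 i : 0 <= alpha i <= 1 by have /andP[? ?] := a01' i; rewrite !ltW.
have [w wmax] := greedy_word alpha (ltnW hN).
set c := Num.min (8^-1) (C / (48 * 2 `^ tau)).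
have c01 : 0 < c <= 1.
  rewrite lt_min ge_min divr_gt0 ?mulr_gt0 ?powR_gt0 //=.
  by rewrite invr_gt0 ltr0n /=; apply/orP; left; lra.
have lower n : (forall m, (m < n)%N -> 0 < gauss_iter alpha w m (w m)) ->
    c * gauss_prod alpha w n `^ (5 + tau) <= gauss_iter alpha w n (w n).
  by move=> pos; exact: DC_gauss_lower_bound (wmax n).
(* Strong induction: positive selected entries before [n] give the lower bound at [n], which is
   itself positive. Hence no term of the series is infinite. *)
have pos n : 0 < gauss_iter alpha w n (w n).
  elim/ltn_ind: n => n IH; apply: lt_le_trans (lower n IH).
  by have /andP[? _] := c01; rewrite mulr_gt0 // powR_gt0 // gauss_prod_gt0.
have posn n m : (m < n)%N -> 0 < gauss_iter alpha w m (w m) by [].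
apply: (@le_lt_trans _ _ (brjuno_word alpha w)).
  by apply: ereal_inf_lbound; exists w.
pose D := 2 * (5 + tau) - ln c.
have D0 : 0 <= D.
  by have /andP[_ /ln_le0] := c01; rewrite /D; lra.
(* [D] comes from the logarithmic estimate; the other factor and the ratio come from the square root
   of the bound [2 / 2 ^+ n] on [gauss_prod]. *)
apply: (@nneseries_geometric_lty _ _ (D * Num.sqrt 2) (Num.sqrt 2^-1)).
  by rewrite sqrtr_ge0 /= -[ltRHS]sqrtr1 ltr_sqrt //; lra.
move=> n; have b0 := gauss_prod_gt0 (posn n); have m0 := pos n.
have b1 := gauss_prod_le1 (posn n) a01.
rewrite inver gt_eqF // lne_EFin ?invr_gt0 // -EFinM !lee_fin.
rewrite -/(gauss_prod alpha w n); apply/andP; split.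
  rewrite mulr_ge0 ?(ltW b0) // ln_ge0 // invf_ge1 //.
  by have /andP[] := gauss_iter01 (posn n) a01 (w n).
have := mul_ln_inv_le_sqrt c01 (_ : 0 <= 5 + tau)
  (_ : 0 < gauss_prod alpha w n <= 1) (lower n (posn n)).
rewrite b0 b1 -/D => /(_ _ isT) h; apply: le_trans (h _) _; first by lra.
rewrite -mulrA ler_wpM2l //.
have -> : Num.sqrt 2 * Num.sqrt 2^-1 ^+ n = Num.sqrt (2 / 2 ^+ n) :> R.
  apply/eqP; rewrite -(@eqrXn2 _ 2) ?mulr_ge0 ?exprn_ge0 ?sqrtr_ge0 //.
  rewrite exprMn exprAC !sqr_sqrtr ?divr_ge0 ?exprn_ge0 //.
  by rewrite exprVn.
exact/ler_wsqrtr/gauss_prod_le.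
Qed.
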